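(* Let $K$ be a finite set with $|K|\ge2$ and $C,C_1,D,D_1$ nonempty countable sets. Let $u\in\Delta(K\times(C\times C_1)\times(D\times D_1))$ and $v=\mathrm{marg}_{K\times C\times D}u$, and let $\varepsilon\ge0$. Suppose that, under $u$, $d_1$ is $\varepsilon$-conditionally independent from $(k,c)$ given $d$, and $c_1$ is $\varepsilon$-conditionally independent from $(k,d)$ given $c$. Then $d(u,v)\le\varepsilon$.
   Context: For a distribution $\mu\in\Delta(X\times Y\times Z)$ over countable spaces, the random variables $x$ and $y$ are $\varepsilon$-conditionally independent given $z$ if $\sum_z\mu(z)\sum_{x,y}|\mu(x,y|z)-\mu(x|z)\mu(y|z)|\le\varepsilon$. An information structure is a probability on triples (state $k\in K$, signal of player 1, signal of player 2) with countably many signals; player 1 is the maximizer, player 2 the minimizer. In $u$ the signals are $(c,c_1)$ for player 1 and $(d,d_1)$ for player 2; in $v$ they are $c$ and $d$. A payoff function is a map $g:K\times I\times J\to[-1,1]$ with $I,J$ finite nonempty sets; $\mathcal G$ is the set of all payoff functions. $\mathrm{val}(u,g)$ is the value of the zero-sum Bayesian game in which the state and signals are drawn from $u$, each player learns his own signal, they simultaneously choose $i\in I$, $j\in J$ (mixed actions depending on own signal allowed), and player 1 receives $g(k,i,j)$ from player 2. $d(u,v)=\sup_{g\in\mathcal G}|\mathrm{val}(u,g)-\mathrm{val}(v,g)|$. $\mathrm{marg}$ denotes marginal distributions. *)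

(* Defs.v *)
From mathcomp Require Import all_boot all_order all_algebra.
From mathcomp Require Import all_classical all_reals all_analysis.

Set Implicit Arguments.
Unset Strict Implicit.
Unset Printing Implicit Defensive.

Import Order.TTheory GRing.Theory Num.Theory.

Local Open Scope classical_set_scope.
Local Open Scope ring_scope.

Record distr (R : realType) (T : countType) := Distr {
  mass :> T -> R ;
  mass_ge0 : forall t, 0 <= mass t ;
  mass_sum1 : (\esum_(t in [set: T]) (mass t)%:E = 1)%E }.

Section Law.
Context (R : realType) (T S : countType) (f : T -> S) (mu : distr R T).

Definition law_mass (s : S) : R :=
  fine (\esum_(t in f @^-1` [set s]) (mu t)%:E)%E.

Lemma law_mass_ge0 s : 0 <= law_mass s.
Proof. by apply/fine_ge0/esum_ge0 => t _; rewrite lee_fin mass_ge0. Qed.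

Lemma EFin_law_mass s :
  (law_mass s)%:E = (\esum_(t in f @^-1` [set s]) (mu t)%:E)%E.
Proof.
have mu0 t : (0 <= (mu t)%:E)%E by rewrite lee_fin mass_ge0.
rewrite fineK// ge0_fin_numE; last exact: esum_ge0.
apply: (@le_lt_trans _ _ 1%E); last exact: ltry.
by rewrite -(mass_sum1 mu) (esumID (f @^-1` [set s]) setT)// setTI leeDl ?esum_ge0.
Qed.

Lemma law_mass_sum1 : (\esum_(s in [set: S]) (law_mass s)%:E = 1)%E.
Proof.
under eq_esum do rewrite EFin_law_mass.
rewrite (esum_esum (a := fun _ t => (mu t)%:E)); last first.
  by move=> s t _ _; rewrite lee_fin mass_ge0.
rewrite -(mass_sum1 mu).
rewrite (reindex_esum [set: T] _ (fun t => (f t, t)))//; split=> //.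
  by move=> x y _ _ [].
by move=> [s t] /= [_ <-]; exists t.
Qed.

(* Image of mu under f; marginals are the case where f is a projection. *)
Definition law : distr R S := Distr law_mass_ge0 law_mass_sum1.

End Law.

(* When mu(z) = 0 the conditional probabilities are read as x / 0 = 0; the
   factor mu(z) makes such z irrelevant. *)
Definition eps_cond_indep (R : realType) (X Y Z : countType) (eps : R)
    (mu : distr R (X * Y * Z)%type) : Prop :=
  let muZ := law (fun t : X * Y * Z => t.2) mu in
  let muXZ := law (fun t : X * Y * Z => (t.1.1, t.2)) mu in
  let muYZ := law (fun t : X * Y * Z => (t.1.2, t.2)) mu in
  (\esum_(z in [set: Z]) ((muZ z)%:E *
     \esum_(p in [set: X * Y])
       (`| mu (p.1, p.2, z) / muZ z -
           (muXZ (p.1, z) / muZ z) * (muYZ (p.2, z) / muZ z) |)%:E)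
   <= eps%:E)%E.

Section Game.
Context (R : realType) (K : finType) (C D : countType).
Context (u : distr R (K * C * D)%type).
Context (I J : finType) (g : K -> I -> J -> R).

Definition outcome_prob (s : C -> distr R I) (t : D -> distr R J)
    (k : K) (i : I) (j : J) : R :=
  fine (\esum_(p in [set: C * D]) (u (k, p.1, p.2) * s p.1 i * t p.2 j)%:E)%E.

Definition payoff (s : C -> distr R I) (t : D -> distr R J) : R :=
  \sum_k \sum_i \sum_j outcome_prob s t k i j * g k i j.

Definition maxmin : \bar R :=
  ereal_sup (range (fun s => ereal_inf (range (fun t => (payoff s t)%:E)))).

Definition minmax : \bar R :=
  ereal_inf (range (fun t => ereal_sup (range (fun s => (payoff s t)%:E)))).

Definition is_value (w : R) : Prop := maxmin = w%:E /\ minmax = w%:E.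

(* The unique w with is_value w. The default 0 is never used when I and J are
   nonempty, since the game then has a value (minmax theorem). *)
Definition val_game : R := xget 0 [set w | is_value w].

End Game.

(* The two structures share the state space but may have different signals. *)
Definition value_dist (R : realType) (K : finType) (C D C' D' : countType)
    (u : distr R (K * C * D)%type) (v : distr R (K * C' * D')%type) : \bar R :=
  ereal_sup [set x : \bar R |
    exists (I J : finType) (g : K -> I -> J -> R),
      [/\ (0 < #|I|)%N, (0 < #|J|)%N,
          (forall k i j, -1 <= g k i j <= 1)
        & x = (`| val_game u g - val_game v g |)%:E]].

(* Main.v *)
Require Import Defs.
From mathcomp Require Import all_boot all_order all_algebra.
From mathcomp Require Import all_classical all_reals all_analysis.
From mathcomp Require Import ring lra.

Import Order.TTheory GRing.Theory Num.Theory.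

Local Open Scope ring_scope.

Set Implicit Arguments.
Unset Strict Implicit.

(** Let player 2 use, in the finer structure, a strategy that is near
    optimal in the coarser one, hence depends on d only. Against it, a
    strategy of player 1 that uses c1 earns the expectation of a function of
    (c1, (k, d), c) bounded by 1. If c1 is drawn afresh from its conditional
    law given c, the result is the payoff in the coarser structure of the
    strategy of player 1 that averages over c1; approximate conditional
    independence says that the redrawing moves the law of (c1, (k, d), c) by
    at most eps in l1 norm, hence the payoff by at most eps
    ([cond_indep_kernel], [average_strategy]). So the value rises by at most
    eps, and exchanging the players, it falls by at most eps.

    The argument bounds the upper value from above and the lower value from
    below, so it also takes the equality of the two, with countably many
    signals ([is_value_exists]). Suppose that player 2 can keep every
    strategy of player 1 down to a. Player 1 runs regret matching separately
    at each signal: at c, action i is played in proportion to the positive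
    part of its accumulated regret. Player 2 answers every round by a
    strategy that keeps the payoff below a. At each c the sum of squares of
    the positive regrets grows at most linearly with the number n of rounds,
    with a coefficient proportional to the square of the probability of c
    ([potential_step]); therefore the total regret over all signals is
    O(sqrt n), and the average of the answers of player 2 keeps every
    strategy down to a + O(1 / sqrt n) ([approx_minimax]). Working signal by
    signal avoids any truncation of the signal sets and any compactness.

    Payoffs and regrets are signed, so the sums over countable sets are
    first developed for absolutely summable real families. *)

(** * Absolutely summable real families *)

Section TotalSum.
Local Open Scope classical_set_scope.
Local Open Scope ring_scope.
Context {R : realType}.
Implicit Types T S : choiceType.

Definition nnsum T (f : T -> R) : R := fine (\esum_(t in [set: T]) (f t)%:E)%E.

(** Splitting f into positive and negative parts reduces signed sums to sums
    of nonnegative families, which are defined without any order on the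
    index set. *)
Definition tsum T (f : T -> R) : R :=
  nnsum (fun t => Num.max (f t) 0) - nnsum (fun t => Num.max (- f t) 0).

Definition abs_summable T (f : T -> R) : Prop :=
  (\esum_(t in [set: T]) `|f t|%:E < +oo)%E.

Lemma abs_summable_le T (f g : T -> R) :
  (forall t, `|f t| <= `|g t|) -> abs_summable g -> abs_summable f.
Proof.
by move=> fg; apply: le_lt_trans; apply: le_esum => t _; rewrite lee_fin fg.
Qed.

Lemma esum_fin T (f : T -> R) : (forall t, 0 <= f t) -> abs_summable f ->
  ((nnsum f)%:E = \esum_(t in [set: T]) (f t)%:E)%E.
Proof.
move=> f0 sf; rewrite /nnsum fineK// ge0_fin_numE.
  apply: le_lt_trans sf; apply: le_esum => t _.
  by rewrite lee_fin ler_norm.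
by apply: esum_ge0 => t _; rewrite lee_fin.
Qed.

Lemma abs_summableD T (f g : T -> R) : abs_summable f -> abs_summable g ->
  abs_summable (fun t => f t + g t).
Proof.
move=> sf sg; apply: (@le_lt_trans _ _
  (\esum_(t in [set: T]) (`|f t|%:E + `|g t|%:E))%E).
  by apply: le_esum => t _; rewrite -EFinD lee_fin ler_normD.
by rewrite esumD//; exact: lte_add_pinfty.
Qed.

Lemma esumZ_le T (f : T -> \bar R) (c : R) : 0 <= c ->
  (forall t, (0 <= f t)%E) ->
  (\esum_(t in [set: T]) (c%:E * f t) <= c%:E * \esum_(t in [set: T]) f t)%E.
Proof.
move=> c0 f0; apply: ge_ereal_sup => _ [X [finX XT] <-].
rewrite -ge0_mule_fsumr//; apply: lee_wpmul2l; first by rewrite lee_fin.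
by apply: ereal_sup_ubound; exists X.
Qed.

Lemma esumZ T (f : T -> \bar R) (c : R) : 0 <= c -> (forall t, (0 <= f t)%E) ->
  (\esum_(t in [set: T]) (c%:E * f t) = c%:E * \esum_(t in [set: T]) f t)%E.
Proof.
move=> c0 f0; apply/eqP; rewrite eq_le esumZ_le//=.
have [->|cn0] := eqVneq c 0.
  by rewrite mul0e; apply: esum_ge0 => t _; rewrite mul0e.
have {cn0}c0 : 0 < c by rewrite lt_def cn0.
rewrite -lee_pdivlMl//; apply: le_trans (esumZ_le _ _).
- by apply: le_esum => t _; rewrite muleA -EFinM mulVf ?mul1e// gt_eqF.
- by rewrite invr_ge0 ltW.
- by move=> t; rewrite mule_ge0// lee_fin ltW.
Qed.

Lemma abs_summableZ T (f : T -> R) (c : R) : abs_summable f ->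
  abs_summable (fun t => c * f t).
Proof.
rewrite /abs_summable => sf.
under eq_esum do rewrite normrM EFinM.
by rewrite esumZ//; apply: lte_mul_pinfty.
Qed.

Lemma abs_summableN T (f : T -> R) : abs_summable f ->
  abs_summable (fun t => - f t).
Proof. by apply: abs_summable_le => t; rewrite normrN. Qed.

Lemma abs_summableB T (f g : T -> R) : abs_summable f -> abs_summable g ->
  abs_summable (fun t => f t - g t).
Proof. by move=> sf sg; apply: abs_summableD => //; exact: abs_summableN. Qed.

Lemma abs_summable0 T : abs_summable (fun _ : T => 0 : R).
Proof. by rewrite /abs_summable esum1 ?ltry// => t _; rewrite normr0. Qed.

Lemma abs_summable_sum T (I : Type) (r : seq I) (f : I -> T -> R) :
  (forall i, abs_summable (f i)) -> abs_summable (fun t => \sum_(i <- r) f i t).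
Proof.
move=> sf; elim: r => [|i r IHr].
  by apply: abs_summable_le (abs_summable0 T) => t; rewrite big_nil.
apply: abs_summable_le (abs_summableD (sf i) IHr) => t.
by rewrite big_cons.
Qed.

Lemma nnsumD T (f g : T -> R) : (forall t, 0 <= f t) -> (forall t, 0 <= g t) ->
  abs_summable f -> abs_summable g ->
    nnsum (fun t => f t + g t) = nnsum f + nnsum g.
Proof.
move=> f0 g0 sf sg; apply: EFin_inj; rewrite EFinD !esum_fin//.
- by under eq_esum do rewrite EFinD; rewrite esumD// => t _; rewrite lee_fin.
- by move=> t; rewrite addr_ge0.
- exact: abs_summableD.
Qed.

Lemma abs_summable_pos T (f : T -> R) : abs_summable f ->
  abs_summable (fun t => Num.max (f t) 0).
Proof. by apply: abs_summable_le => t; case: (leP (f t) 0) => _;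
  rewrite ?normr0. Qed.

Lemma max0_ge0 (x : R) : 0 <= Num.max x 0.
Proof. by rewrite le_max lexx orbT. Qed.

Lemma posnegE (x : R) : x = Num.max x 0 - Num.max (- x) 0.
Proof. by case: (leP x 0); case: (leP (- x) 0); lra. Qed.

(** Any other decomposition of a summable family as a difference of nonnegative
    families gives the same sum; additivity of the sum follows from this. *)
Lemma tsum_diff T (f g : T -> R) :
  (forall t, 0 <= f t) -> (forall t, 0 <= g t) -> abs_summable f ->
    abs_summable g ->
  tsum (fun t => f t - g t) = nnsum f - nnsum g.
Proof.
move=> f0 g0 sf sg; rewrite /tsum.
have sfg : abs_summable (fun t => f t - g t) by exact: abs_summableB.
apply/eqP; rewrite subr_eq addrAC -subr_eq opprK addrC; apply/eqP.
rewrite -!nnsumD//; try by move=> t; exact: max0_ge0.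
- congr nnsum; apply/funext => t.
  by have := posnegE (f t - g t); lra.
- exact/abs_summable_pos/abs_summableN.
- exact: abs_summable_pos.
Qed.

Lemma nnsum0 T : nnsum (fun _ : T => 0 : R) = 0.
Proof. by rewrite /nnsum esum1. Qed.

Lemma tsum_nnsum T (f : T -> R) : (forall t, 0 <= f t) -> tsum f = nnsum f.
Proof.
move=> f0; rewrite /tsum.
have -> : (fun t => Num.max (- f t) 0) = (fun=> 0).
  by apply/funext => t; rewrite max_r// oppr_le0.
rewrite nnsum0 subr0; congr nnsum; apply/funext => t.
by rewrite max_l.
Qed.

Lemma nnsum_ge0 T (f : T -> R) : (forall t, 0 <= f t) -> 0 <= nnsum f.
Proof. by move=> f0; apply/fine_ge0/esum_ge0 => t _; rewrite lee_fin. Qed.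

Lemma tsum_ge0 T (f : T -> R) : (forall t, 0 <= f t) -> 0 <= tsum f.
Proof. by move=> f0; rewrite tsum_nnsum// nnsum_ge0. Qed.

Lemma eq_tsum T (f g : T -> R) : f =1 g -> tsum f = tsum g.
Proof. by move=> /funext ->. Qed.

Lemma tsumN T (f : T -> R) : tsum (fun t => - f t) = - tsum f.
Proof.
rewrite /tsum opprB; congr (_ - nnsum _).
by apply/funext => t; rewrite opprK.
Qed.

Lemma tsumD T (f g : T -> R) : abs_summable f -> abs_summable g ->
  tsum (fun t => f t + g t) = tsum f + tsum g.
Proof.
move=> sf sg.
rewrite (@eq_tsum _ _ (fun t => (Num.max (f t) 0 + Num.max (g t) 0) -
   (Num.max (- f t) 0 + Num.max (- g t) 0))); last first.
  by move=> t; rewrite {1}(posnegE (f t)) {1}(posnegE (g t)); ring.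
rewrite tsum_diff.
- rewrite !nnsumD; do ?by move=> t; exact: max0_ge0.
  + by rewrite /tsum; ring.
  + exact/abs_summable_pos/abs_summableN.
  + exact/abs_summable_pos/abs_summableN.
  + exact/abs_summable_pos.
  + exact/abs_summable_pos.
- by move=> t; rewrite addr_ge0 ?max0_ge0.
- by move=> t; rewrite addr_ge0 ?max0_ge0.
- by apply: abs_summableD; exact: abs_summable_pos.
- by apply: abs_summableD; exact/abs_summable_pos/abs_summableN.
Qed.

Lemma tsumB T (f g : T -> R) : abs_summable f -> abs_summable g ->
  tsum (fun t => f t - g t) = tsum f - tsum g.
Proof. by move=> sf sg; rewrite tsumD ?tsumN//; exact: abs_summableN. Qed.

Lemma tsumZ T (f : T -> R) (c : R) : abs_summable f ->
  tsum (fun t => c * f t) = c * tsum f.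
Proof.
wlog c0 : c / 0 <= c => [H sf|sf].
  have [/H->//|c0] := leP 0 c.
  rewrite (@eq_tsum _ _ (fun t => - (- c * f t))).
    by rewrite tsumN H// ?oppr_ge0 ?ltW// mulNr opprK.
  by move=> t; rewrite mulNr opprK.
have Z (g : T -> R) : abs_summable g -> (forall t, 0 <= g t) ->
    nnsum (fun t => c * g t) = c * nnsum g.
  move=> sg g0; apply: EFin_inj; rewrite EFinM !esum_fin//.
  - by under eq_esum do rewrite EFinM; rewrite esumZ// => t; rewrite lee_fin.
  - by move=> t; rewrite mulr_ge0.
  - exact: abs_summableZ.
rewrite /tsum mulrBr -!Z.
- by congr (_ - _); congr nnsum; apply/funext => t;
    rewrite maxr_pMr// mulr0// mulrN.
- exact/abs_summable_pos/abs_summableN.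
- by move=> t; exact: max0_ge0.
- exact/abs_summable_pos.
- by move=> t; exact: max0_ge0.
Qed.

Lemma tsum_sum T (I : Type) (r : seq I) (f : I -> T -> R) :
  (forall i, abs_summable (f i)) ->
  tsum (fun t => \sum_(i <- r) f i t) = \sum_(i <- r) tsum (f i).
Proof.
move=> sf; elim: r => [|i r IHr].
  rewrite big_nil (@eq_tsum _ _ (fun=> 0)) ?tsum_nnsum ?nnsum0//.
  by move=> t; rewrite big_nil.
rewrite big_cons -IHr -tsumD//; last exact: abs_summable_sum.
by apply: eq_tsum => t; rewrite big_cons.
Qed.

Lemma ler_tsum T (f g : T -> R) : abs_summable f -> abs_summable g ->
  (forall t, f t <= g t) ->
  tsum f <= tsum g.
Proof.
move=> sf sg fg; rewrite -subr_ge0 -tsumB//.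
by apply: tsum_ge0 => t; rewrite subr_ge0.
Qed.

Lemma abs_summable_norm T (f : T -> R) : abs_summable f ->
  abs_summable (fun t => `|f t|).
Proof. by apply: abs_summable_le => t; rewrite normr_id. Qed.

Lemma ler_norm_tsum T (f : T -> R) : abs_summable f ->
  `|tsum f| <= tsum (fun t => `|f t|).
Proof.
move=> sf; rewrite ler_norml -tsumN; apply/andP; split; apply: ler_tsum => //.
- exact/abs_summableN/abs_summable_norm.
- by move=> t; rewrite lerNl -normrN ler_norm.
- exact: abs_summable_norm.
- by move=> t; rewrite ler_norm.
Qed.

Lemma tsum_bij T S (h : T -> S) (f : S -> R) : bijective h ->
  tsum (fun t => f (h t)) = tsum f.
Proof.
rewrite -setTT_bijective => bh.
by rewrite /tsum /nnsum; congr (fine _ - fine _); apply/esym;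
  rewrite (reindex_esum _ _ _ _ bh).
Qed.

Lemma abs_summable_bij T S (h : T -> S) (f : S -> R) : bijective h ->
  abs_summable (fun t => f (h t)) <-> abs_summable f.
Proof.
rewrite -setTT_bijective => bh.
by rewrite /abs_summable (reindex_esum _ _ _ (fun s => `|f s|%:E) bh).
Qed.

Lemma tsum_fin (T : finType) (f : T -> R) : tsum f = \sum_t f t.
Proof.
have E (g : T -> R) : (forall t, 0 <= g t) -> nnsum g = \sum_t g t.
  move=> g0; rewrite /nnsum.
  have -> : [set: T] = [set` index_enum T].
    by apply/seteqP; split => t //= _; rewrite mem_index_enum.
  rewrite esum_fset//; last by move=> t _; rewrite lee_fin.
  by rewrite -fsbig_seq ?index_enum_uniq// sumEFin.
rewrite /tsum !E; do ?by move=> t; exact: max0_ge0.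
rewrite -sumrB; apply: eq_bigr => t _.
exact/esym/posnegE.
Qed.

Lemma abs_summable_fin (T : finType) (f : T -> R) : abs_summable f.
Proof.
rewrite /abs_summable.
have -> : [set: T] = [set` index_enum T].
  by apply/seteqP; split => t //= _; rewrite mem_index_enum.
rewrite esum_fset//.
by rewrite -fsbig_seq ?index_enum_uniq// sumEFin ltry.
Qed.

Lemma abs_summable1 T (t0 : T) (f : T -> R) :
  (forall t, t != t0 -> f t = 0) -> abs_summable f.
Proof.
move=> f0; rewrite /abs_summable (esumID [set t0])// setTI esum_set1//.
rewrite esum1 ?adde0 ?ltry//.
by move=> t /= [_ /eqP tt0]; rewrite f0// normr0.
Qed.

Lemma tsum1 T (t0 : T) (f : T -> R) : (forall t, t != t0 -> f t = 0) ->
  tsum f = f t0.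
Proof.
move=> f0.
have E (g : T -> R) : (forall t, 0 <= g t) -> (forall t, t != t0 -> g t = 0) ->
    nnsum g = g t0.
  move=> g0 gt; rewrite /nnsum (esumID [set t0])// => [|t _]; last first.
    by rewrite lee_fin.
  rewrite setTI esum_set1 ?lee_fin// esum1 ?adde0//.
  by move=> t /= [_ /eqP tt0]; rewrite gt.
rewrite /tsum !E; do ?by move=> t; exact: max0_ge0.
- exact/esym/posnegE.
- by move=> t tt0; rewrite f0// oppr0 maxxx.
- by move=> t tt0; rewrite f0// maxxx.
Qed.

Lemma esum_pair T S (f : T * S -> \bar R) : (forall p, (0 <= f p)%E) ->
  (\esum_(p in [set: T * S]) f p =
   \esum_(t in [set: T]) \esum_(s in [set: S]) f (t, s))%E.
Proof.
move=> f0; rewrite (_ : [set: T * S] = [set: T] `*`` (fun=> [set: S])).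
  rewrite (@esum_esum _ _ _ _ _ (fun t s => f (t, s)))//.
  by apply: eq_esum => -[].
by apply/seteqP; split => // -[].
Qed.

Lemma abs_summable_slice T S (f : T * S -> R) : abs_summable f ->
  forall t, abs_summable (fun s => f (t, s)).
Proof.
move=> sf t; apply: le_lt_trans sf.
rewrite esum_pair//.
have s0 x : (0 <= \esum_(s in [set: S]) `|f (x, s)|%:E)%E by exact: esum_ge0.
rewrite [leRHS](esumID [set t])// setTI esum_set1//.
by rewrite leeDl// esum_ge0.
Qed.

Lemma abs_summable_tsum T S (f : T * S -> R) : abs_summable f ->
  abs_summable (fun t => tsum (fun s => f (t, s))).
Proof.
move=> sf; apply: le_lt_trans (sf); rewrite esum_pair//.
apply: le_esum => t _.
have sft := abs_summable_slice sf t.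
apply: (@le_trans _ _ (nnsum (fun s => `|f (t, s)|))%:E).
  by rewrite lee_fin -tsum_nnsum//; exact: ler_norm_tsum.
by rewrite esum_fin//; exact: abs_summable_norm.
Qed.

(** Fubini: apply Tonelli to the positive and the negative part. *)
Lemma tsum_pair T S (f : T * S -> R) : abs_summable f ->
  tsum f = tsum (fun t => tsum (fun s => f (t, s))).
Proof.
move=> sf.
have N (g : T * S -> R) : (forall p, 0 <= g p) -> abs_summable g ->
    nnsum g = tsum (fun t => tsum (fun s => g (t, s))).
  move=> g0 sg; rewrite tsum_nnsum; last by move=> t; exact: tsum_ge0.
  apply: EFin_inj; rewrite !esum_fin//.
  - rewrite esum_pair//; apply: eq_esum => t _.
    by rewrite tsum_nnsum// esum_fin//; exact: (abs_summable_slice sg).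
  - by move=> t; exact: tsum_ge0.
  - exact: abs_summable_tsum.
have sp := abs_summable_pos sf; have sn := abs_summable_pos (abs_summableN sf).
rewrite {1}/tsum !N//; do ?by move=> t; exact: max0_ge0.
rewrite -tsumB; [|exact: abs_summable_tsum sp|exact: abs_summable_tsum sn].
apply: eq_tsum => t; rewrite -tsumB.
- apply: eq_tsum => s.
  exact/esym/posnegE.
- exact: (abs_summable_slice sp).
- exact: (abs_summable_slice sn).
Qed.

(** The hypothesis on slices is needed because [tsum] has a junk value on
    families that are not summable. *)
Lemma abs_summable_pair T S (f : T * S -> R) :
  (forall t, abs_summable (fun s => f (t, s))) ->
  abs_summable (fun t => tsum (fun s => `|f (t, s)|)) -> abs_summable f.
Proof.
move=> sft; apply: le_lt_trans; rewrite esum_pair//; apply: le_esum => t _.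
rewrite ger0_norm ?tsum_ge0// tsum_nnsum// esum_fin//.
exact: abs_summable_norm.
Qed.

Lemma tsum_swap T S (f : T * S -> R) : abs_summable f ->
  tsum (fun t => tsum (fun s => f (t, s))) =
  tsum (fun s => tsum (fun t => f (t, s))).
Proof.
move=> sf; rewrite -tsum_pair//.
have bij_swap : bijective (fun p : S * T => (p.2, p.1)).
  by exists (fun p => (p.2, p.1)) => -[].
rewrite -(tsum_bij _ bij_swap) tsum_pair//.
exact: (abs_summable_bij f bij_swap).2.
Qed.

End TotalSum.

(** * Expectations, image laws and conditional resampling *)

Section Expectation.
Local Open Scope classical_set_scope.
Local Open Scope ring_scope.
Context {R : realType}.
Implicit Types T S X Y Z : countType.

Lemma distr_of T (f : T -> R) : (forall t, 0 <= f t) -> abs_summable f ->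
  tsum f = 1 ->
  exists mu : distr R T, forall t, mu t = f t.
Proof.
move=> f0 sf f1.
have E : (\esum_(t in [set: T]) (f t)%:E = 1)%E.
  by rewrite -esum_fin// -tsum_nnsum// f1.
by exists (Distr f0 E).
Qed.

Lemma abs_summable_mass T (mu : distr R T) : abs_summable mu.
Proof.
rewrite /abs_summable.
under eq_esum do rewrite ger0_norm ?mass_ge0//.
by rewrite mass_sum1 ltry.
Qed.

Lemma tsum_mass T (mu : distr R T) : tsum mu = 1.
Proof. by rewrite tsum_nnsum ?/nnsum ?mass_sum1//; exact: mass_ge0. Qed.

Lemma sum_mass (I : finType) (mu : distr R I) : \sum_i mu i = 1.
Proof. by rewrite -tsum_fin tsum_mass. Qed.

Definition expect T (mu : distr R T) (F : T -> R) : R :=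
  tsum (fun t => mu t * F t).

Lemma abs_summable_expect T (mu : distr R T) (F : T -> R) (M : R) :
  (forall t, `|F t| <= M) -> abs_summable (fun t => mu t * F t).
Proof.
move=> FM; apply: abs_summable_le (abs_summableZ M (abs_summable_mass mu)) => t.
rewrite !normrM mulrC ler_wpM2r// (le_trans (FM t))//.
exact: ler_norm.
Qed.

Lemma eq_expect T (mu : distr R T) (F G : T -> R) :
  F =1 G -> expect mu F = expect mu G.
Proof. by move=> /funext ->. Qed.

Lemma expect_cst T (mu : distr R T) (c : R) : expect mu (fun=> c) = c.
Proof.
rewrite /expect (@eq_tsum _ _ _ (fun t => c * mu t)); last first.
  by move=> t; rewrite mulrC.
by rewrite tsumZ ?tsum_mass ?mulr1//; exact: abs_summable_mass.
Qed.

Lemma ler_expect T (mu : distr R T) (F G : T -> R) (M N : R) :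
  (forall t, `|F t| <= M) -> (forall t, `|G t| <= N) ->
  (forall t, F t <= G t) -> expect mu F <= expect mu G.
Proof.
move=> FM GN FG; apply: ler_tsum.
- exact: abs_summable_expect FM.
- exact: abs_summable_expect GN.
- by move=> t; rewrite ler_wpM2l// mass_ge0.
Qed.

Lemma norm_expect_le T (mu : distr R T) (F : T -> R) (M : R) :
  (forall t, `|F t| <= M) -> `|expect mu F| <= M.
Proof.
move=> FM.
have MM (t : T) : `|M| <= M.
  by rewrite ger0_norm// (le_trans _ (FM t)).
have NM (t : T) : `|- M| <= M by rewrite normrN; exact: MM.
have [lo hi] : (forall t, - M <= F t) /\ (forall t, F t <= M).
  by split=> t; have := FM t; rewrite ler_norml => /andP[].
have := ler_expect mu NM FM lo; have := ler_expect mu FM MM hi.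
by rewrite !expect_cst ler_norml => -> ->.
Qed.

Lemma law_massE T S (f : T -> S) (mu : distr R T) s :
  law f mu s = expect mu (fun t => (f t == s)%:R).
Proof.
rewrite /expect tsum_nnsum/=; last first.
  by move=> t; rewrite mulr_ge0// mass_ge0.
rewrite /law_mass esum_mkcond; congr fine; apply: eq_esum => t _.
case: ifPn => [|/negP]; rewrite inE/= => fts.
  by rewrite fts eqxx mulr1.
by rewrite (_ : f t == s = false) ?mulr0//; apply/eqP.
Qed.

(** Change of variables: expand the mass of s as the sum of mu t over f t =
    s and exchange the two sums. *)
Lemma expect_law T S (f : T -> S) (mu : distr R T) (F : S -> R) (M : R) :
  (forall s, `|F s| <= M) -> expect (law f mu) F = expect mu (fun t => F (f t)).
Proof.
move=> FM.
pose h (p : T * S) := mu p.1 * (f p.1 == p.2)%:R * F p.2.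
have h0 t s : s != f t -> h (t, s) = 0.
  by move=> sft; rewrite /h/= eq_sym (negbTE sft) mulr0 mul0r.
have sh : abs_summable h.
  apply: abs_summable_pair => [t|]; first exact: (abs_summable1 (h0 t)).
  have sF : abs_summable (fun t => mu t * F (f t)).
    by apply: (@abs_summable_expect _ _ (fun t => F (f t)) M) => t.
  apply: abs_summable_le sF => t.
  rewrite (tsum1 (t0 := f t)) => [|s sft]; last by rewrite h0// normr0.
  by rewrite /h/= eqxx mulr1 normr_id.
rewrite /expect.
transitivity (tsum (fun s => tsum (fun t => h (t, s)))).
  apply: eq_tsum => s; rewrite law_massE mulrC -tsumZ.
    by apply: eq_tsum => t; rewrite /h/= mulrC.
  by apply: (@abs_summable_expect _ _ _ 1) => t; case: (_ == _);
    rewrite ?normr0 ?normr1.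
rewrite -tsum_swap//; apply: eq_tsum => t.
by rewrite (tsum1 (h0 t)) /h/= eqxx mulr1.
Qed.

Lemma norm_indic_le1 (b : bool) : `|b%:R| <= 1 :> R.
Proof. by case: b; rewrite ?normr0 ?normr1. Qed.

Lemma law_comp T S X (f : T -> S) (g : S -> X) (mu : distr R T) x :
  law g (law f mu) x = law (fun t => g (f t)) mu x.
Proof.
rewrite !law_massE (@expect_law _ _ _ _ _ 1)// => s.
exact: norm_indic_le1.
Qed.

Lemma mass_le_law T S (f : T -> S) (mu : distr R T) t :
  mu t <= law f mu (f t).
Proof.
have H0 t' : t' != t -> mu t' * (t' == t)%:R = 0.
  by move=> /negbTE ->; rewrite mulr0.
rewrite law_massE -[leLHS]mulr1 -[X in mu t * X](_ : (t == t)%:R = 1);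
  last first.
  by rewrite eqxx.
rewrite -(tsum1 H0); apply: ler_expect => t'; try exact: norm_indic_le1.
by case: (t' =P t) => [->|]; rewrite ?eqxx//=; case: (_ == _).
Qed.

Lemma norm_mass_le1 (T : countType) (p : distr R T) t : `|p t| <= 1.
Proof.
have := mass_le_law (fun=> tt) p t; rewrite law_massE expect_cst eqxx.
by rewrite ger0_norm ?mass_ge0.
Qed.

Lemma law_sndE X Z (nu : distr R (X * Z)%type) z :
  law snd nu z = tsum (fun x => nu (x, z)).
Proof.
have s1 : abs_summable (fun p : X * Z => nu p * (p.2 == z)%:R).
  by apply: (@abs_summable_expect _ _ _ 1) => p; exact: norm_indic_le1.
rewrite law_massE /expect tsum_pair//.
apply: eq_tsum => x; rewrite (tsum1 (t0 := z)) /= ?eqxx ?mulr1// => z'.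
by move=> /negbTE ->; rewrite mulr0.
Qed.

(** The kernel [kap] is the conditional law of x given z. Resampling x from it
    replaces mu by P(x, y, z) = mu(y, z) mu(x, z) / mu(z), and the defect of
    conditional independence is exactly the l1 distance between mu and P. *)
Lemma cond_indep_kernel X Y Z (eps : R) (mu : distr R (X * Y * Z)%type) :
  eps_cond_indep eps mu ->
  exists kap : Z -> distr R X, forall G : X -> Y -> Z -> R,
    (forall x y z, `|G x y z| <= 1) ->
    `|expect mu (fun t => G t.1.1 t.1.2 t.2) -
      expect mu (fun t => expect (kap t.2) (fun x => G x t.1.2 t.2))| <= eps.
Proof.
rewrite /eps_cond_indep.
set muZ := law _ mu; set muXZ := law _ mu; set muYZ := law _ mu => H.
have muZX z : law snd muXZ z = muZ z by rewrite law_comp.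
have muZY z : law snd muYZ z = muZ z by rewrite law_comp.
have muZ0 z : 0 <= muZ z by exact: mass_ge0.
have muXZ0 x z : muZ z = 0 -> muXZ (x, z) = 0.
  move=> z0; apply/eqP; rewrite eq_le mass_ge0 andbT -z0 -muZX.
  exact: (@mass_le_law _ _ snd muXZ).
have muYZ0 y z : muZ z = 0 -> muYZ (y, z) = 0.
  move=> z0; apply/eqP; rewrite eq_le mass_ge0 andbT -z0 -muZY.
  exact: (@mass_le_law _ _ snd muYZ).
have mu0 x y z : muZ z = 0 -> mu (x, y, z) = 0.
  move=> z0; apply/eqP; rewrite eq_le mass_ge0 andbT -z0.
  exact: (@mass_le_law _ _ (fun t : X * Y * Z => t.2) mu).
have sX z : abs_summable (fun x => muXZ (x, z)).
  have bij_swap : bijective (fun p : Z * X => (p.2, p.1)).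
    by exists (fun p => (p.2, p.1)) => -[].
  exact: (abs_summable_slice ((abs_summable_bij muXZ bij_swap).2
    (abs_summable_mass _))).
have /choice[kap kapE] : forall z, exists nu : distr R X,
    muZ z <> 0 -> forall x, nu x = muXZ (x, z) / muZ z.
  move=> z; have [z0|/eqP z0] := pselect (muZ z = 0).
    (* Signals z of mass 0 do not contribute, so any law of x serves there. *)
    by exists (law (fun t : X * Y * Z => t.1.1) mu).
  have [||| nu nuE] := @distr_of X (fun x => (muZ z)^-1 * muXZ (x, z)).
  - by move=> x; rewrite mulr_ge0 ?invr_ge0// mass_ge0.
  - exact: abs_summableZ.
  - by rewrite tsumZ// -law_sndE muZX mulVf.
  by exists nu => _ x; rewrite nuE mulrC.
exists kap => G G1.
pose P (t : X * Y * Z) := muYZ (t.1.2, t.2) * (muXZ (t.1.1, t.2) / muZ t.2).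
have Pdef x y z : P (x, y, z) = muYZ (y, z) * (muXZ (x, z) / muZ z) by [].
have PE x y z : P (x, y, z) = muYZ (y, z) * kap z x.
  rewrite Pdef; have [z0|z0] := pselect (muZ z = 0).
    by rewrite muYZ0// !mul0r.
  by rewrite kapE.
have scaled x y z : `|mu (x, y, z) - P (x, y, z)| =
    muZ z * `|mu (x, y, z) / muZ z -
              muXZ (x, z) / muZ z * (muYZ (y, z) / muZ z)|.
  have [z0|z0] := eqVneq (muZ z) 0.
    by rewrite Pdef mu0// muYZ0// z0 !mul0r subrr normr0.
  rewrite -{1}(ger0_norm (muZ0 z)) -normrM Pdef; congr (`|_|).
  by field.
have Heps : (\esum_(t in [set: X * Y * Z]) `|mu t - P t|%:E <= eps%:E)%E.
  apply: le_trans H.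
  have bij_swap : bijective (fun p : Z * (X * Y) => (p.2, p.1)).
    by exists (fun p => (p.2, p.1)) => -[].
  have bs := bij_swap; rewrite -setTT_bijective in bs.
  rewrite (reindex_esum _ _ _ (fun t => `|mu t - P t|%:E) bs) esum_pair//.
  apply: le_esum => z _; rewrite -esumZ//.
  apply: le_esum => -[x y] _; rewrite -EFinM lee_fin.
  by rewrite le_eqVlt; apply/orP; left; apply/eqP; exact: scaled.
have sd : abs_summable (fun t => mu t - P t).
  exact: le_lt_trans Heps (ltry _).
have sP : abs_summable P.
  apply: abs_summable_le (abs_summableB (abs_summable_mass mu) sd) => t.
  by rewrite opprB addrC subrK.
have sPG : abs_summable (fun t => P t * G t.1.1 t.1.2 t.2).
  by apply: abs_summable_le sP => t; rewrite normrM ler_piMr.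
rewrite (_ : expect mu (fun t => expect (kap t.2) _) =
             tsum (fun t => P t * G t.1.1 t.1.2 t.2)); last first.
  have bij_rot : bijective (fun p : Y * Z * X => (p.2, p.1.1, p.1.2)).
    by exists (fun t => (t.1.2, t.2, t.1.1)) => [[[]]|[[]]].
  rewrite -(tsum_bij _ bij_rot) tsum_pair; last first.
    exact: (abs_summable_bij (fun t => P t * G t.1.1 t.1.2 t.2) bij_rot).2.
  rewrite -(@expect_law _ _ (fun t => (t.1.2, t.2)) mu
     (fun q => expect (kap q.2) (fun x => G x q.1 q.2)) 1); last first.
    by move=> q; apply: norm_expect_le => x.
  apply: eq_tsum => -[y z]/=; rewrite -tsumZ.
    by apply: eq_tsum => x; rewrite PE mulrA.
  by apply: (@abs_summable_expect _ _ _ 1) => x.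
rewrite /expect -tsumB//; last by apply: (@abs_summable_expect _ _ _ 1) => x.
rewrite -lee_fin; apply: le_trans Heps.
apply: (@le_trans _ _ (nnsum (fun t => `|mu t - P t|))%:E); last first.
  by rewrite esum_fin//; exact: abs_summable_norm.
rewrite lee_fin -tsum_nnsum//.
have sdG : abs_summable
    (fun t => mu t * G t.1.1 t.1.2 t.2 - P t * G t.1.1 t.1.2 t.2).
  by apply: abs_summableB => //; apply: (@abs_summable_expect _ _ _ 1) => x.
apply: le_trans (ler_norm_tsum sdG) _; apply: ler_tsum.
- exact: abs_summable_norm.
- exact: abs_summable_norm.
- by move=> t; rewrite -mulrBl normrM ler_piMr.
Qed.

End Expectation.

(** * Regret matching at one signal *)

Section RegretMatching.
Local Open Scope ring_scope.
Context {R : realType} (I : finType).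
Implicit Types (x : I -> R) (p : distr R I).

Lemma distr_fin x : (forall i, 0 <= x i) -> \sum_i x i = 1 ->
  exists p : distr R I, forall i, p i = x i.
Proof. by move=> x0 x1; apply: distr_of => //;
  [exact: abs_summable_fin|rewrite tsum_fin]. Qed.

Lemma inhabited_distr : (0 < #|I|)%N -> inhabited (distr R I).
Proof.
move=> I0; have [| |p _] := @distr_fin (fun=> #|I|%:R^-1); last by exists.
- by move=> _; rewrite invr_ge0.
- have I1 : #|I|%:R != 0 :> R by rewrite pnatr_eq0 -lt0n.
  by rewrite sumr_const -[RHS](mulVf I1) mulr_natr.
Qed.

Lemma norm_mean_le p x (M : R) : (forall i, `|x i| <= M) ->
  `|\sum_i p i * x i| <= M.
Proof.
move=> xM; apply: le_trans (ler_norm_sum _ _ _) _.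
rewrite -[leRHS]mul1r -(sum_mass p) mulr_suml; apply: ler_sum => i _.
by rewrite normrM ger0_norm ?mass_ge0// ler_wpM2l// mass_ge0.
Qed.

(** Playing in proportion to the positive parts of the regrets x makes the next
    regret r i - sum_j p j * r j orthogonal to them, whatever the gains r. *)
Lemma regret_matching x : (0 < #|I|)%N ->
  exists p, forall r : I -> R,
    \sum_i Num.max (x i) 0 * (r i - \sum_j p j * r j) = 0.
Proof.
move=> I0; set s := \sum_i Num.max (x i) 0.
have [s0|s0] := eqVneq s 0.
  have [p] := inhabited_distr I0; exists p => r.
  have xi0 i : Num.max (x i) 0 = 0.
    move/eqP: s0; rewrite psumr_eq0 => [|j _]; last exact: max0_ge0.
    by move/allP => /(_ i); rewrite mem_index_enum => /(_ isT) /eqP.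
  by rewrite big1// => i _; rewrite xi0 mul0r.
have [| |p pE] := @distr_fin (fun i => Num.max (x i) 0 / s).
- move=> i; rewrite divr_ge0 ?max0_ge0//.
  by apply: sumr_ge0 => j _; exact: max0_ge0.
- by rewrite -mulr_suml mulfV.
exists p => r.
under eq_bigr do rewrite mulrBr.
rewrite sumrB -mulr_suml -/s mulr_sumr; apply/eqP; rewrite subr_eq0; apply/eqP.
by apply: eq_bigr => i _; rewrite pE; field.
Qed.

(** Orthogonality kills the cross term in the square of x^+ + r, and
    (x + r)^+ is at most the absolute value of x^+ + r. *)
Lemma potential_step x (r : I -> R) (w : R) :
  \sum_i Num.max (x i) 0 * r i = 0 -> (forall i, `|r i| <= w) ->
  \sum_i Num.max (x i + r i) 0 ^+ 2 <=
  \sum_i Num.max (x i) 0 ^+ 2 + #|I|%:R * w ^+ 2.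
Proof.
move=> orth rw.
have -> : \sum_i Num.max (x i) 0 ^+ 2 + #|I|%:R * w ^+ 2 =
   \sum_i (Num.max (x i) 0 ^+ 2 + 2 * (Num.max (x i) 0 * r i) + w ^+ 2).
  by rewrite !big_split/= -mulr_sumr orth mulr0 addr0 sumr_const mulr_natl.
apply: ler_sum => i _.
have rw2 : r i ^+ 2 <= w ^+ 2.
  by rewrite -real_normK ?num_real// lerXn2r ?nnegrE// (le_trans _ (rw i)).
apply: (@le_trans _ _ ((Num.max (x i) 0 + r i) ^+ 2)); last first.
  by rewrite sqrrD -mulr_natl; lra.
have [xr|xr] := leP (x i + r i) 0; first by rewrite expr0n/= sqr_ge0.
rewrite lerXn2r ?nnegrE//.
- exact: ltW.
- by rewrite (le_trans (ltW xr))// lerD2r le_max lexx.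
- by rewrite lerD2r le_max lexx.
Qed.

End RegretMatching.

(** * Existence of the value *)

Section Value.
Local Open Scope classical_set_scope.
Local Open Scope ring_scope.
Context {R : realType} (K : finType).
Section OneStructure.
Context (C D : countType) (u : distr R (K * C * D)%type).
Context (I J : finType) (g : K -> I -> J -> R).
Hypothesis g1 : forall k i j, -1 <= g k i j <= 1.
Implicit Types (s : C -> distr R I) (t : D -> distr R J).

Definition stage_payoff (p : distr R I) (q : distr R J) (k : K) : R :=
  \sum_i p i * \sum_j q j * g k i j.

Lemma norm_row_le1 (q : distr R J) k i : `|\sum_j q j * g k i j| <= 1.
Proof. by apply: norm_mean_le => j; rewrite ler_norml. Qed.

Lemma norm_stage_payoff_le1 (p : distr R I) (q : distr R J) k :
  `|stage_payoff p q k| <= 1.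
Proof. by apply: norm_mean_le => i; exact: norm_row_le1. Qed.

Lemma payoffE s t :
  payoff u g s t = expect u (fun x => stage_payoff (s x.1.2) (t x.2) x.1.1).
Proof.
rewrite /expect.
have smix : abs_summable (fun x => u x * stage_payoff (s x.1.2) (t x.2) x.1.1).
  by apply: (@abs_summable_expect _ _ _ _ 1) => x; exact: norm_stage_payoff_le1.
have bij_assoc : bijective (fun p : K * (C * D) => (p.1, p.2.1, p.2.2)).
  by exists (fun p => (p.1.1, (p.1.2, p.2))) => [[? []]|[[]]].
have su k : abs_summable (fun p : C * D => u (k, p.1, p.2)).
  exact: (abs_summable_slice ((abs_summable_bij u bij_assoc).2
    (abs_summable_mass u)) k).
rewrite -(tsum_bij _ bij_assoc) tsum_pair; last first.
  exact: (abs_summable_bij (fun x =>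
    u x * stage_payoff (s x.1.2) (t x.2) x.1.1) bij_assoc).2.
rewrite tsum_fin /payoff; apply: eq_bigr => k _ /=.
have sij i j : abs_summable
    (fun p : C * D => u (k, p.1, p.2) * s p.1 i * t p.2 j).
  apply: abs_summable_le (su k) => p; rewrite !normrM -mulrA ler_piMr//.
  by rewrite mulr_ile1// norm_mass_le1.
transitivity (\sum_i \sum_j
    tsum (fun p : C * D => g k i j * (u (k, p.1, p.2) * s p.1 i * t p.2 j))).
  apply: eq_bigr => i _; apply: eq_bigr => j _.
  rewrite tsumZ// mulrC tsum_nnsum// => p.
  by rewrite !mulr_ge0// mass_ge0.
under eq_bigr => i _ do [rewrite -tsum_sum; last by move=> j;
  exact: abs_summableZ].
rewrite -tsum_sum; last by move=> i; apply: abs_summable_sum => j;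
  exact: abs_summableZ.
apply: eq_tsum => p; rewrite mulr_sumr; apply: eq_bigr => i _.
by rewrite !mulr_sumr; apply: eq_bigr => j _; ring.
Qed.

Lemma norm_payoff_le1 s t : `|payoff u g s t| <= 1.
Proof.
by rewrite payoffE; apply: norm_expect_le => x; exact: norm_stage_payoff_le1.
Qed.

Definition signal_prob (c : C) : R := tsum (fun q : K * D => u (q.1, c, q.2)).

(** What action i earns player 1 at signal c against t, not divided by the
    probability of c; thus [gain] is bounded by [signal_prob] and sums over c. *)
Definition gain t (c : C) (i : I) : R :=
  tsum (fun q : K * D => u (q.1, c, q.2) * \sum_j t q.2 j * g q.1 i j).

Let bij_rot : bijective (fun q : C * (K * D) => (q.2.1, q.1, q.2.2)).
Proof. by exists (fun p => (p.1.2, (p.1.1, p.2))) => [[? []]|[[]]]. Qed.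

Let abs_summable_u : abs_summable
  (fun q : C * (K * D) => u (q.2.1, q.1, q.2.2)).
Proof. exact: (abs_summable_bij u bij_rot).2 (abs_summable_mass _). Qed.

Lemma signal_prob_ge0 c : 0 <= signal_prob c.
Proof. by apply: tsum_ge0 => q; exact: mass_ge0. Qed.

Lemma abs_summable_signal_prob : abs_summable signal_prob.
Proof. exact: (abs_summable_tsum abs_summable_u). Qed.

Lemma tsum_signal_prob : tsum signal_prob = 1.
Proof. by rewrite -(tsum_mass u) -(tsum_bij _ bij_rot) tsum_pair. Qed.

Lemma abs_summable_gain t c i :
  abs_summable (fun q : K * D => u (q.1, c, q.2) * \sum_j t q.2 j * g q.1 i j).
Proof.
apply: abs_summable_le (abs_summable_slice abs_summable_u c) => q.
by rewrite normrM ler_piMr// norm_row_le1.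
Qed.

Lemma norm_gain_le t c i : `|gain t c i| <= signal_prob c.
Proof.
apply: le_trans (ler_norm_tsum (abs_summable_gain t c i)) _; apply: ler_tsum.
- exact/abs_summable_norm/abs_summable_gain.
- exact: (abs_summable_slice abs_summable_u c).
- move=> q; rewrite normrM ger0_norm ?mass_ge0//.
  by rewrite ler_piMr ?mass_ge0// norm_row_le1.
Qed.

Lemma payoff_gain s t :
  payoff u g s t = tsum (fun c => \sum_i s c i * gain t c i).
Proof.
rewrite payoffE /expect -(tsum_bij _ bij_rot) tsum_pair; last first.
  apply: (abs_summable_bij (fun x =>
    u x * stage_payoff (s x.1.2) (t x.2) x.1.1) bij_rot).2.
  by apply: (@abs_summable_expect _ _ _ _ 1) => x; exact: norm_stage_payoff_le1.
apply: eq_tsum => c /=.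
under [RHS]eq_bigr => i _ do [rewrite -tsumZ; last exact: abs_summable_gain].
rewrite -tsum_sum; last by move=> i; apply/abs_summableZ/abs_summable_gain.
apply: eq_tsum => q; rewrite /stage_payoff mulr_sumr; apply: eq_bigr => i _.
by rewrite mulrCA.
Qed.

Lemma convex_combination (n : nat) (t t' : D -> distr R J) :
  exists t'' : D -> distr R J, forall s,
    n.+1%:R * payoff u g s t'' = n%:R * payoff u g s t + payoff u g s t'.
Proof.
have n0 : (n.+1%:R : R) != 0 by rewrite pnatr_eq0.
have /choice[t'' t''E] : forall d, exists q : distr R J,
    forall j, q j = (n%:R * t d j + t' d j) / n.+1%:R.
  move=> d; apply: distr_fin => [j|].
    by rewrite divr_ge0// addr_ge0 ?mulr_ge0 ?mass_ge0.
  by rewrite -mulr_suml big_split/= -mulr_sumr !sum_mass mulr1 natr1 mulfV.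
exists t'' => s.
have smix (t0 : D -> distr R J) :
    abs_summable (fun x => u x * stage_payoff (s x.1.2) (t0 x.2) x.1.1).
  by apply: (@abs_summable_expect _ _ _ _ 1) => x; exact: norm_stage_payoff_le1.
rewrite !payoffE /expect -!tsumZ// -tsumD//; last exact: abs_summableZ.
apply: eq_tsum => x.
rewrite mulrCA [n%:R * _]mulrCA -mulrDr; congr (_ * _).
rewrite /stage_payoff !mulr_sumr -big_split; apply: eq_bigr => i _ /=.
rewrite mulrCA [n%:R * _]mulrCA -mulrDr; congr (_ * _).
rewrite !mulr_sumr -big_split; apply: eq_bigr => j _ /=.
by rewrite t''E; field.
Qed.

(** After n rounds, t is the average of the answers of player 2 and x c i
    the regret accumulated for action i at signal c. The answers earn player
    1 at most a per round, so the last inequality says that a fixed strategy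
    s could have gained over n * a at most its regret. *)
Lemma regret_dynamics (a : R) : (0 < #|I|)%N ->
  (forall s, exists t, payoff u g s t <= a) ->
  forall n, exists t (x : C -> I -> R),
    [/\ forall c i, `|x c i| <= n%:R * (2 * signal_prob c),
        forall c, \sum_i Num.max (x c i) 0 ^+ 2 <=
                  n%:R * (#|I|%:R * (2 * signal_prob c) ^+ 2)
      & forall s, n%:R * payoff u g s t <=
                  n%:R * a + tsum (fun c => \sum_i s c i * x c i)].
Proof.
move=> I0 reply; elim=> [|n [t [x [xw xpot xpay]]]].
  have [p] := @inhabited_distr R I I0; have [t _] := reply (fun=> p).
  exists t, (fun=> fun=> 0); split=> [c i|c|s].
  - by rewrite normr0 mul0r.
  - by rewrite mul0r big1// => i _; rewrite maxxx expr0n.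
  - rewrite !mul0r add0r tsum_ge0// => c.
    by rewrite big1// => i _; rewrite mulr0.
have /choice[s' s'E] c := regret_matching (x c) I0.
(* s' is chosen from the past regrets, and only then does player 2 answer. *)
have [t' t'a] := reply s'.
have [t'' t''E] := convex_combination n t t'.
pose r c i := gain t' c i - \sum_j s' c j * gain t' c j.
have rw c i : `|r c i| <= 2 * signal_prob c.
  rewrite mulr2n mulrDl mul1r; apply: le_trans (ler_normB _ _) _.
  apply: lerD; first exact: norm_gain_le.
  by apply: norm_mean_le => j; exact: norm_gain_le.
exists t'', (fun c i => x c i + r c i); split=> [c i|c|s].
- apply: le_trans (ler_normD _ _) _.
  by rewrite -natr1 mulrDl mul1r lerD.
- apply: le_trans (potential_step (s'E c _) (rw c)) _.
  by rewrite -[n.+1%:R]natr1 [leRHS]mulrDl mul1r lerD2r.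
- have sw (y : C -> I -> R) (M : R) : (forall c i, `|y c i| <= M * signal_prob c) ->
      abs_summable (fun c => \sum_i s c i * y c i).
    move=> yM; apply: abs_summable_le (abs_summableZ M abs_summable_signal_prob)
      => c.
    by apply: le_trans (ler_norm _); exact: norm_mean_le.
  have sx : abs_summable (fun c => \sum_i s c i * x c i).
    by apply: (sw _ (n%:R * 2)) => c i; rewrite -mulrA.
  have sg (s0 : C -> distr R I) :
    abs_summable (fun c => \sum_i s0 c i * gain t' c i).
    apply: abs_summable_le abs_summable_signal_prob => c.
    rewrite (ger0_norm (signal_prob_ge0 c)).
    by apply: norm_mean_le => i; exact: norm_gain_le.
  have -> : tsum (fun c => \sum_i s c i * (x c i + r c i)) =
      tsum (fun c => \sum_i s c i * x c i) +
      (payoff u g s t' - payoff u g s' t').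
    rewrite !payoff_gain -tsumB// -tsumD//; last exact: abs_summableB.
    apply: eq_tsum => c; under eq_bigr do rewrite mulrDr /r mulrBr.
    by rewrite big_split/= sumrB -[in X in _ - X]mulr_suml sum_mass mul1r.
  rewrite t''E -natr1 mulrDl mul1r.
  by have := xpay s; lra.
Qed.

(** With n at least 4 #|I| / e ^ 2 rounds, the potential bounds each regret at
    signal c by n * e * signal_prob c, and the weights sum to 1. *)
Lemma approx_minimax (a e : R) : (0 < #|I|)%N -> 0 < e ->
  (forall s, exists t, payoff u g s t <= a) ->
  exists t, forall s, payoff u g s t <= a + e.
Proof.
move=> I0 e0 reply.
have [n [n0 nI]] : exists n : nat,
    0 < n%:R :> R /\ #|I|%:R * 4 <= n%:R * e ^+ 2.
  exists (Num.truncn (#|I|%:R * 4 / e ^+ 2)).+1; rewrite ltr0n; split=> //.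
  by rewrite -ler_pdivrMr ?exprn_gt0// ltW// truncnS_gt.
have [t [x [xw xpot xpay]]] := regret_dynamics I0 reply n.
exists t => s; rewrite -(ler_pM2l n0); apply: le_trans (xpay s) _.
have -> : n%:R * (a + e) = n%:R * a + tsum (fun c => n%:R * e * signal_prob c).
  by rewrite tsumZ ?tsum_signal_prob ?mulr1 ?mulrDr//; exact: abs_summable_signal_prob.
rewrite lerD2l.
have new c : 0 <= n%:R * e * signal_prob c.
  by rewrite !mulr_ge0 ?signal_prob_ge0// ltW.
apply: ler_tsum => [||c].
- apply: abs_summable_le (abs_summableZ (n%:R * 2) abs_summable_signal_prob) => c.
  by apply: le_trans (ler_norm _); apply: norm_mean_le => i; rewrite -mulrA.
- exact/abs_summableZ/abs_summable_signal_prob.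
- rewrite (_ : n%:R * e * signal_prob c = \sum_i s c i * (n%:R * e * signal_prob c));
  last first.
    by rewrite -mulr_suml sum_mass mul1r.
  apply: ler_sum => i _.
  apply: ler_wpM2l; first exact: mass_ge0.
  apply: (@le_trans _ _ (Num.max (x c i) 0)); first by rewrite le_max lexx.
  rewrite -(ler_pXn2r (n := 2%N))// ?nnegrE ?max0_ge0//.
  apply: (@le_trans _ _ (\sum_i Num.max (x c i) 0 ^+ 2)).
    by rewrite (bigD1 i)//= lerDl sumr_ge0// => j _; exact: sqr_ge0.
  apply: le_trans (xpot c) _.
  rewrite [leLHS](_ : _ = n%:R * (#|I|%:R * 4) * signal_prob c ^+ 2); last by ring.
  rewrite [leRHS](_ : _ = n%:R * (n%:R * e ^+ 2) * signal_prob c ^+ 2); last by ring.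
  by rewrite ler_wpM2r ?sqr_ge0// ler_wpM2l// ltW.
Qed.

Lemma payoff_bounds s t : -1 <= payoff u g s t <= 1.
Proof. by rewrite -ler_norml norm_payoff_le1. Qed.

Lemma maxmin_ge s (a : R) :
  (forall t, a <= payoff u g s t) -> (a%:E <= maxmin u g)%E.
Proof.
move=> sa; apply: (@le_trans _ _ (ereal_inf (range (fun t =>
  (payoff u g s t)%:E)))).
  by apply: le_ereal_inf_tmp => _ [t _ <-]; rewrite lee_fin.
by apply: ereal_sup_ubound; exists s.
Qed.

Lemma minmax_le t (a : R) :
  (forall s, payoff u g s t <= a) -> (minmax u g <= a%:E)%E.
Proof.
move=> ta; apply: (@le_trans _ _ (ereal_sup (range (fun s =>
  (payoff u g s t)%:E)))).
  by apply: ereal_inf_lbound; exists t.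
by apply: ge_ereal_sup => _ [s _ <-]; rewrite lee_fin.
Qed.

Lemma maxmin_le_minmax : (maxmin u g <= minmax u g)%E.
Proof.
apply: ge_ereal_sup => _ [s _ <-]; apply: le_ereal_inf_tmp => _ [t _ <-].
apply: (@le_trans _ _ (payoff u g s t)%:E).
  by apply: ereal_inf_lbound; exists t.
by apply: ereal_sup_ubound; exists s.
Qed.

Hypothesis I0 : (0 < #|I|)%N.
Hypothesis J0 : (0 < #|J|)%N.

(** Against every s some t holds the payoff below any number above [maxmin],
    so [approx_minimax] bounds [minmax] by that number up to an arbitrary
    margin. *)
Lemma is_value_exists : exists w, is_value u g w.
Proof.
have [p] := @inhabited_distr R I I0; have [q] := @inhabited_distr R J J0.
have lo : ((-1)%:E <= maxmin u g)%E.
  by apply: (@maxmin_ge (fun=> p)) => t;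
    have /andP[] := payoff_bounds (fun=> p) t.
have hi : (minmax u g <= 1%:E)%E.
  by apply: (@minmax_le (fun=> q)) => s;
    have /andP[] := payoff_bounds s (fun=> q).
have [m mE] : exists m, maxmin u g = m%:E.
  exists (fine (maxmin u g)); rewrite fineK// fin_numElt.
  rewrite (lt_le_trans _ lo) ?ltNyr//=.
  by rewrite (le_lt_trans maxmin_le_minmax)// (le_lt_trans hi)// ltry.
exists m; split=> //; apply/eqP; rewrite eq_le; apply/andP; split; last first.
  by rewrite -mE maxmin_le_minmax.
apply/lee_addgt0Pr => e e0.
have e2 : 0 < e / 2 by rewrite divr_gt0.
have [s|t ta] := @approx_minimax (m + e / 2) (e / 2) I0 e2.
  have : (ereal_inf (range (fun t => (payoff u g s t)%:E)) < (m + e / 2)%:E)%E.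
    apply: (@le_lt_trans _ _ m%:E); last by rewrite lte_fin ltrDl.
    by rewrite -mE; apply: ereal_sup_ubound; exists s.
  by move=> /ereal_inf_lt[_ [t _ <-]]; rewrite lte_fin => /ltW ?; exists t.
rewrite -EFinD; apply: (@minmax_le t) => s.
by rewrite [e]splitr addrA.
Qed.

Lemma val_game_is_value : is_value u g (val_game u g).
Proof. by have [w wv] := is_value_exists;
  exact: (xgetPex 0 (ex_intro _ w wv)). Qed.

Lemma val_game_le t (a : R) :
  (forall s, payoff u g s t <= a) -> val_game u g <= a.
Proof. by move=> ta; rewrite -lee_fin -val_game_is_value.2;
  exact: minmax_le ta. Qed.

Lemma val_game_ge s (a : R) :
  (forall t, a <= payoff u g s t) -> a <= val_game u g.
Proof. by move=> sa; rewrite -lee_fin -val_game_is_value.1;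
  exact: maxmin_ge sa. Qed.

Lemma near_optimal_min (e : R) : 0 < e ->
  exists t, forall s, payoff u g s t <= val_game u g + e.
Proof.
move=> e0; have : (minmax u g < (val_game u g + e)%:E)%E.
  by rewrite val_game_is_value.2 lte_fin ltrDl.
move=> /ereal_inf_lt[_ [t _ <-]] /ltW ta; exists t => s.
rewrite -lee_fin; apply: le_trans ta.
by apply: ereal_sup_ubound; exists s.
Qed.

Lemma near_optimal_max (e : R) : 0 < e ->
  exists s, forall t, val_game u g - e <= payoff u g s t.
Proof.
move=> e0; have : ((val_game u g - e)%:E < maxmin u g)%E.
  by rewrite val_game_is_value.1 lte_fin gtrBl.
move=> /ereal_sup_gt[_ [s _ <-]] /ltW sa; exists s => t.
rewrite -lee_fin; apply: le_trans sa _.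
by apply: ereal_inf_lbound; exists t.
Qed.

End OneStructure.
End Value.

(** * Comparison of the two structures *)

Section Averaging.
Context {R : realType}.

(** [cond_indep_kernel] pulled back to the space on which the triple is defined,
    so that it applies to expectations under the full information structure. *)
Lemma cond_indep_resample (T X Y Z : countType) (eps : R) (u : distr R T)
    (f : T -> X * Y * Z) :
  eps_cond_indep eps (law f u) ->
  exists kap : Z -> distr R X, forall G : X -> Y -> Z -> R,
    (forall x y z, `|G x y z| <= 1) ->
    `|expect u (fun t => G (f t).1.1 (f t).1.2 (f t).2) -
      expect u (fun t => expect (kap (f t).2)
                                (fun x => G x (f t).1.2 (f t).2))| <= eps.
Proof.
move=> /cond_indep_kernel[kap H]; exists kap => G G1; have := H G G1.
rewrite (@expect_law _ _ _ f u (fun t => G t.1.1 t.1.2 t.2) 1)//.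
rewrite (@expect_law _ _ _ f u
  (fun t => expect (kap t.2) (fun x => G x t.1.2 t.2)) 1)// => t.
by apply: norm_expect_le.
Qed.

Lemma expect_sumZ (X : countType) (I : finType) (kap : distr R X)
    (f : I -> X -> R) (y : I -> R) : (forall i x, `|f i x| <= 1) ->
  expect kap (fun x => \sum_i y i * f i x) = \sum_i y i * expect kap (f i).
Proof.
move=> f1.
have sf i : abs_summable (fun x => kap x * f i x).
  by apply: (@abs_summable_expect _ _ _ _ 1).
rewrite /expect.
under [RHS]eq_bigr => i _ do rewrite -tsumZ//.
rewrite -tsum_sum; last by move=> i; exact: abs_summableZ.
apply: eq_tsum => x; rewrite mulr_sumr; apply: eq_bigr => i _.
by rewrite mulrCA.
Qed.

(** Payoffs are linear in the mixed action, so the strategy that averages s over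
    the resampled signal earns the averaged payoff for any gains y. *)
Lemma average_strategy (X C : countType) (I : finType) (kap : C -> distr R X)
    (s : C * X -> distr R I) :
  exists s' : C -> distr R I, forall c (y : I -> R),
    \sum_i s' c i * y i = expect (kap c) (fun x => \sum_i s (c, x) i * y i).
Proof.
have /choice[s' s'E] : forall c, exists p : distr R I,
    forall i, p i = expect (kap c) (fun x => s (c, x) i).
  move=> c; apply: distr_fin => [i|].
    by apply: tsum_ge0 => x; rewrite mulr_ge0// mass_ge0.
  transitivity (expect (kap c) (fun x => \sum_i 1 * s (c, x) i)).
    rewrite expect_sumZ => [|i x]; last exact: norm_mass_le1.
    by apply: eq_bigr => i _; rewrite mul1r.
  rewrite -[RHS](expect_cst (kap c) 1); apply: eq_expect => x.
  by under eq_bigr do rewrite mul1r; rewrite sum_mass.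
exists s' => c y.
rewrite (_ : expect _ _ = expect (kap c) (fun x => \sum_i y i * s (c, x) i));
  last first.
  by apply: eq_expect => x; apply: eq_bigr => i _; rewrite mulrC.
rewrite expect_sumZ => [|i x]; last exact: norm_mass_le1.
by apply: eq_bigr => i _; rewrite s'E mulrC.
Qed.

Lemma stage_payoff_swap (K I J : finType) (g : K -> I -> J -> R)
    (p : distr R I) (q : distr R J) k :
  stage_payoff g p q k = \sum_j q j * \sum_i p i * g k i j.
Proof.
rewrite /stage_payoff; under eq_bigr do rewrite mulr_sumr.
rewrite exchange_big; apply: eq_bigr => j _; rewrite mulr_sumr.
by apply: eq_bigr => i _; rewrite mulrCA.
Qed.

End Averaging.

Theorem proposition5 (R : realType) (K : finType) (C C1 D D1 : countType)
  (hK : (2 <= #|K|)%N)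
  (hC : inhabited C) (hC1 : inhabited C1)
  (hD : inhabited D) (hD1 : inhabited D1)
  (u : distr R (K * (C * C1) * (D * D1))%type)
  (eps : R) (heps : 0 <= eps)
  (h2 : eps_cond_indep eps
     (law (fun '((k, (c, c1)), (d, d1)) => (d1, (k, c), d)) u))
  (h1 : eps_cond_indep eps
     (law (fun '((k, (c, c1)), (d, d1)) => (c1, (k, d), c)) u)) :
  (value_dist u (law (fun '((k, (c, c1)), (d, d1)) => (k, c, d)) u)
   <= eps%:E)%E.
Proof.
have [kap1 H1] := cond_indep_resample h1.
have [kap2 H2] := cond_indep_resample h2.
apply: ge_ereal_sup => _ [I [J [g [I0 J0 g1 ->]]]]; rewrite lee_fin.
set v := law _ u.
rewrite ler_norml lerBlDr lerBrDr; apply/andP; split;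
  apply/ler_addgt0Pr => e e0.
(* Resampling d1 given d turns t into the strategy t' of the coarser game. *)
- have [s opt] := near_optimal_max v g1 I0 J0 e0.
  rewrite -lerBlDr; apply: (val_game_ge g1 I0 J0 (s := fun x => s x.1)) => t.
  have [t' t'E] := average_strategy kap2 t.
  have := H2 (fun d1 kc d => stage_payoff g (s kc.2) (t (d, d1)) kc.1)
             (fun _ _ _ => norm_stage_payoff_le1 g1 _ _ _).
  set A := expect u _; set B := expect u _ => AB.
  have uA : payoff u g (fun x => s x.1) t = A.
    by rewrite payoffE//; apply: eq_expect => -[[k [c c1]] [d d1]].
  have vB : payoff v g s t' = B.
    rewrite payoffE// (@expect_law _ _ _ _ u _ 1); last first.
      by move=> x; exact: norm_stage_payoff_le1.
    apply: eq_expect => -[[k [c c1]] [d d1]] /=.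
    by rewrite stage_payoff_swap t'E; apply: eq_expect => x;
      rewrite stage_payoff_swap.
  have := opt t'; rewrite uA vB; move: AB; rewrite ler_norml => /andP[]; lra.
(* Resampling c1 given c turns s into the strategy s' of the coarser game. *)
- have [t opt] := near_optimal_min v g1 I0 J0 e0.
  apply: (val_game_le g1 I0 J0 (t := fun x => t x.1)) => s.
  have [s' s'E] := average_strategy kap1 s.
  have := H1 (fun c1 kd c => stage_payoff g (s (c, c1)) (t kd.2) kd.1)
             (fun _ _ _ => norm_stage_payoff_le1 g1 _ _ _).
  set A := expect u _; set B := expect u _ => AB.
  have uA : payoff u g s (fun x => t x.1) = A.
    by rewrite payoffE//; apply: eq_expect => -[[k [c c1]] [d d1]].
  have vB : payoff v g s' t = B.
    rewrite payoffE// (@expect_law _ _ _ _ u _ 1); last first.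
      by move=> x; exact: norm_stage_payoff_le1.
    by apply: eq_expect => -[[k [c c1]] [d d1]] /=; exact: s'E.
  have := opt s'; rewrite uA vB; move: AB; rewrite ler_norml => /andP[]; lra.
Qed.
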